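(* Let $S$ be a Boolean monoid. Then $S$ has an invariant mean if, and only if, for no integer $m\ge 1$ does there exist a Tarski matrix of degree $m$ over $S$.
   Context: An inverse semigroup is a semigroup $S$ in which every $a$ has a unique $a^{-1}$ with $a=aa^{-1}a$ and $a^{-1}=a^{-1}aa^{-1}$; all inverse semigroups here have a zero $0$. $E(S)$ is the set of idempotents (a meet-semilattice under multiplication). The natural partial order is $a\le b$ iff $a=be$ for some $e\in E(S)$; joins $\vee$ are taken in this order. Elements $a,b$ are compatible if $a^{-1}b$ and $ab^{-1}$ are idempotents, and orthogonal ($a\perp b$) if $a^{-1}b=ab^{-1}=0$. An inverse semigroup with zero is distributive if every compatible pair has a join and multiplication distributes over such joins; it is a Boolean semigroup if moreover $E(S)$ is a (generalized) Boolean algebra, and a Boolean monoid if it is also a monoid (then $E(S)$ is a Boolean algebra with top $1$). An invariant mean on a Boolean monoid $S$ is a function $\mu:E(S)\to[0,\infty)$ such that $\mu(s^{-1}s)=\mu(ss^{-1})$ for all $s\in S$; $\mu(e\vee f)=\mu(e)+\mu(f)$ for all orthogonal idempotents $e,f$; and $\mu(1)=1$. For finite $m,n\ge 1$, an $m\times n$ (generalized) rook matrix over $S$ is an $m\times n$ matrix $A$ with entries in $S$ such that (RM1) if $a,b$ are entries in the same row and in distinct columns then $a^{-1}b=0$; (RM2) if $a,b$ are entries in the same column and in distinct rows then $ab^{-1}=0$. If $A$ is an $m\times n$ rook matrix and $B$ an $n\times p$ rook matrix, then $(AB)_{ij}=\bigvee_k a_{ik}b_{kj}$ (these joins exist and $AB$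 is a rook matrix). $A^{\ast}$ is the $n\times m$ matrix with $(A^{\ast})_{ij}=a_{ji}^{-1}$. $I_n$ denotes the $n\times n$ identity matrix. A Tarski matrix of degree $m$ over $S$ is an $m\times(m+1)$ rook matrix $A$ over $S$ with $A^{\ast}A=I_{m+1}$. *)

(* Defs.v *)
From HB Require Import structures.
From mathcomp Require Import all_boot all_order all_algebra.
From mathcomp Require Import all_classical all_reals.

Set Implicit Arguments.
Unset Strict Implicit.
Unset Printing Implicit Defensive.

Local Open Scope classical_set_scope.
Local Open Scope group_scope.

(* Inverse semigroups with zero.  The inverse is not the inv operation of
   MathComp's baseGroupType, which is tied to pointed magmas. *)
HB.mixin Record isInverseSemigroup0 S of Semigroup S := {
  sgzero : S;
  sginv : S -> S;
  mul0s : forall a : S, sgzero * a = sgzero;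
  muls0 : forall a : S, a * sgzero = sgzero;
  mulsVs : forall a : S, a * sginv a * a = a;
  mulVsV : forall a : S, sginv a * a * sginv a = sginv a;
  sginv_uniq : forall a b : S, a * b * a = a -> b * a * b = b -> b = sginv a
}.

#[short(type="inverseSemigroup0Type")]
HB.structure Definition InverseSemigroup0 :=
  {S of isInverseSemigroup0 S & Semigroup S}.

(* Shadows the group inverse, which is not used below. *)
Local Notation "x ^-1" := (sginv x) : group_scope.

Section InverseSemigroup0.
Variable S : inverseSemigroup0Type.
Implicit Types a b c s : S.

Definition idempotent a : bool := a * a == a.

Definition nle a b : Prop := exists2 e, idempotent e & a = b * e.

Definition is_join (X : set S) c : Prop :=
  (forall x, X x -> nle x c) /\
  (forall d, (forall x, X x -> nle x d) -> nle c d).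

Definition compatible a b : Prop :=
  idempotent (a^-1 * b) /\ idempotent (a * b^-1).

Definition orthogonal a b : Prop :=
  a^-1 * b = sgzero :> S /\ a * b^-1 = sgzero :> S.

Definition is_distributive : Prop :=
  (forall a b, compatible a b -> exists c, is_join [set a; b] c) /\
  (forall a b c s, compatible a b -> is_join [set a; b] c ->
     is_join [set s * a; s * b] (s * c) /\ is_join [set a * s; b * s] (c * s)).

(* Idempotents are pairwise compatible, so in the presence of
   is_distributive they already form a distributive lattice with bottom
   sgzero (meet is multiplication); being a generalized Boolean algebra then
   amounts to having relative complements. *)
Definition is_boolean : Prop :=
  is_distributive /\
  (forall e f, idempotent e -> idempotent f -> nle e f ->
     exists g, [/\ idempotent g, e * g = sgzero :> S & is_join [set e; g] f]).

Lemma idempotentVs s : idempotent (s^-1 * s).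
Proof. by rewrite /idempotent mulgA mulVsV. Qed.

Lemma idempotentsV s : idempotent (s * s^-1).
Proof. by rewrite /idempotent mulgA mulsVs. Qed.

End InverseSemigroup0.

HB.mixin Record isBooleanSemigroup S of InverseSemigroup0 S := {
  booleansP : is_boolean S
}.

#[short(type="booleanSemigroupType")]
HB.structure Definition BooleanSemigroup :=
  {S of isBooleanSemigroup S & InverseSemigroup0 S}.

#[short(type="booleanMonoidType")]
HB.structure Definition BooleanMonoid :=
  {S of BooleanSemigroup S & Monoid S}.

Lemma idempotent1 (S : booleanMonoidType) : idempotent (1 : S).
Proof. by rewrite /idempotent mulg1. Qed.

Section Means.
Variables (R : realType) (S : booleanMonoidType).

Definition idem : Type := {e : S | idempotent e}.
Definition idem1 : idem := exist _ 1 (idempotent1 S).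
Definition idem_dom (s : S) : idem := exist _ (s^-1 * s) (idempotentVs s).
Definition idem_ran (s : S) : idem := exist _ (s * s^-1) (idempotentsV s).

Definition is_invariant_mean (mu : idem -> R) : Prop :=
  [/\ forall e, (0 <= mu e)%R,
      forall s, mu (idem_dom s) = mu (idem_ran s),
      forall e f g : idem, orthogonal (val e) (val f) ->
        is_join [set val e; val f] (val g) -> mu g = (mu e + mu f)%R
    & mu idem1 = 1%R].

End Means.

Section RookMatrices.
Variable S : booleanMonoidType.

Definition is_rook m n (A : 'M[S]_(m, n)) : Prop :=
  (forall i j j', j != j' -> (A i j)^-1 * A i j' = sgzero :> S) /\
  (forall i i' j, i != i' -> A i j * (A i' j)^-1 = sgzero :> S).

(* C = AB.  The product is a relation because joins in S are partial; joins
   are unique, so C is determined by A and B. *)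
Definition is_rook_mul m n p
    (A : 'M[S]_(m, n)) (B : 'M[S]_(n, p)) (C : 'M[S]_(m, p)) : Prop :=
  forall i j, is_join (range (fun k => A i k * B k j)) (C i j).

Definition rook_star m n (A : 'M[S]_(m, n)) : 'M[S]_(n, m) :=
  (\matrix_(i, j) ((A j i)^-1)%g)%R.

Definition rook_id n : 'M[S]_n :=
  (\matrix_(i, j) if i == j then 1%g else sgzero)%R.

Definition is_tarski m (A : 'M[S]_(m, m.+1)) : Prop :=
  is_rook A /\ is_rook_mul (rook_star A) A (rook_id m.+1).

End RookMatrices.

(* Main.v *)
From mathcomp Require Import all_boot all_order all_algebra.
From mathcomp Require Import all_classical all_reals.
Require Import Defs.

(** Invariant means versus Tarski matrices: the theorem is Tarski's alternative
    between finitely additive invariant measures and paradoxical decompositions,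
    read in the type monoid of [S].

    A Tarski matrix of degree [m] is a paradox.  Its column [j] cuts the [j]-th
    copy of 1 into the domains of the entries, and its row [i] packs the
    corresponding ranges disjointly into the [i]-th copy of 1: so [m + 1] copies
    of 1 fit into [m] copies.  An invariant mean gives an entry's domain and range
    the same value, and summing over all entries yields [m + 1 <= m]
    ([no_tarski_of_mean]).

    Conversely, preorder the formal sums of idempotents by [dissects]: one sum is
    below another if its terms can be cut into finitely many pieces that elements
    of [S] move disjointly into the terms of the other.  This relation is
    transitive ([dissects_trans]) and additive ([dissects_add]), the domain and
    the range of an element are equivalent, and an orthogonal join is equivalent
    to the sum of its parts.  If [m + 1] copies of 1 are below [m] copies, joining
    the pieces with the same source and target gives a Tarski matrix
    ([tarski_of_dissects]).  Without Tarski matrices the preordered monoid thus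
    satisfies the hypothesis of Tarski's theorem ([tarski_state]), whose additive
    functional restricts to an invariant mean on single idempotents.

    Tarski's theorem is proved in the style of Hahn and Banach.  Among the
    subadditive monotone functionals [p] with [p (a + u) = p a + 1], which exist
    in the absence of paradoxes ([gauge_exists]), Zorn's lemma provides a minimal
    one, and a minimal one is additive since any defect of additivity would yield
    a smaller one ([minimal_gauge_nmul], [minimal_gauge_add]). *)

Set Implicit Arguments.
Unset Strict Implicit.
Unset Printing Implicit Defensive.

(** * Inverse semigroups and their natural order *)

Section InverseSemigroupTheory.
Local Open Scope classical_set_scope.
Local Open Scope group_scope.
Local Notation "x ^-1" := (sginv x) : group_scope.

Variable S : inverseSemigroup0Type.
Implicit Types a b c d e f s t x y : S.

Lemma sginvK : involutive (@sginv S).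
Proof. by move=> a; rewrite -(sginv_uniq a^-1 a) ?mulVsV ?mulsVs. Qed.

Lemma idempotentV e : idempotent e -> e^-1 = e.
Proof. by move=> /eqP ee; rewrite -(sginv_uniq e e) // ee ee. Qed.

(** The element [f * (e * f)^-1 * e] is again an inverse of [e * f], hence
    equal to [(e * f)^-1]; in this form it is visibly idempotent. *)
Lemma idempotentM e f : idempotent e -> idempotent f -> idempotent (e * f).
Proof.
move=> /eqP ee /eqP ff; set g := (e * f)^-1.
have gE : g = f * g * e.
  apply/esym/sginv_uniq.
    rewrite -[RHS](mulsVs (e * f)) -/g !mulgA.
    by rewrite -[e * f * f]mulgA ff -[e * f * g * e * e]mulgA ee.
  rewrite !mulgA -[f * g * e * e]mulgA ee -[f * g * e * f * f]mulgA ff.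
  by rewrite -!mulgA; congr (_ * _); rewrite !mulgA -[g * e * f]mulgA mulVsV.
have gg : idempotent g.
  apply/eqP; rewrite [in LHS]gE !mulgA -[f * g * e * f]mulgA -[_ * (e * f)]mulgA.
  by rewrite -[f * (g * (e * f)) * g]mulgA mulVsV -gE.
by rewrite -(sginvK (e * f)) -/g idempotentV.
Qed.

(** By [idempotentM], both [e * f] and [f * e] are inverses of [e * f]. *)
Lemma idempotentC e f : idempotent e -> idempotent f -> e * f = f * e.
Proof.
move=> he hf; rewrite -[LHS]idempotentV ?idempotentM //.
have /eqP efef := idempotentM he hf; have /eqP fefe := idempotentM hf he.
move: he hf => /eqP ee /eqP ff.
symmetry; apply: sginv_uniq.
  by rewrite !mulgA -[e * f * f]mulgA ff -[e * f * e * e]mulgA ee -mulgA efef.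
by rewrite !mulgA -[f * e * e]mulgA ee -[f * e * f * f]mulgA ff -mulgA fefe.
Qed.

Lemma sginvM a b : (a * b)^-1 = b^-1 * a^-1.
Proof.
have C := idempotentC (idempotentsV b) (idempotentVs a).
symmetry; apply: sginv_uniq.
  rewrite -[RHS](congr2 *%g (mulsVs a) (mulsVs b)) -!mulgA; congr (_ * _).
  by rewrite !mulgA -[b * b^-1 * a^-1 * a]mulgA C !mulgA.
rewrite -[RHS](congr2 *%g (mulVsV b) (mulVsV a)) -!mulgA; congr (_ * _).
by rewrite !mulgA -[a^-1 * a * b * b^-1]mulgA -C !mulgA.
Qed.

Lemma sginv0 : (sgzero : S)^-1 = sgzero.
Proof. by apply/idempotentV/eqP; rewrite mul0s. Qed.

Lemma idempotent0 : idempotent (sgzero : S).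
Proof. by rewrite /idempotent mul0s. Qed.

(** An idempotent moves across an element by conjugation. *)
Lemma idempotent_mull e x : idempotent e -> e * x = x * (x^-1 * e * x).
Proof.
move=> he; by rewrite !mulgA (idempotentC (idempotentsV x) he) -!mulgA (mulgA x) mulsVs.
Qed.

Lemma idempotent_mulr x e : idempotent e -> x * e = x * e * x^-1 * x.
Proof.
move=> he; rewrite -!mulgA (idempotentC he (idempotentVs x)).
by rewrite !mulgA mulsVs.
Qed.

Lemma idempotent_conj e x : idempotent e -> idempotent (x * e * x^-1).
Proof.
move=> he; apply/eqP; rewrite !mulgA -(idempotent_mulr x he).
by move: he => /eqP ee; rewrite -[x * e * e]mulgA ee.
Qed.

Lemma idempotent_conjV e x : idempotent e -> idempotent (x^-1 * e * x).
Proof. by move=> /(@idempotent_conj _ x^-1); rewrite sginvK. Qed.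

Lemma mulVs_eq0C x y : x^-1 * y = sgzero -> y^-1 * x = sgzero.
Proof. by move=> /(congr1 (@sginv S)); rewrite sginvM sginvK sginv0. Qed.

Lemma mulsV_eq0C x y : x * y^-1 = sgzero -> y * x^-1 = sgzero.
Proof. by move=> /(congr1 (@sginv S)); rewrite sginvM sginvK sginv0. Qed.

Lemma mulVs_eq0_idem x e y :
  idempotent e -> x^-1 * y = sgzero -> x^-1 * e * y = sgzero.
Proof. by move=> he xy; rewrite -mulgA (idempotent_mull _ he) mulgA xy mul0s. Qed.

Lemma mulsV_eq0_idem x e y :
  idempotent e -> x * y^-1 = sgzero -> x * e * y^-1 = sgzero.
Proof. by move=> he xy; rewrite (idempotent_mulr _ he) -!mulgA xy !muls0. Qed.

Lemma nlexx a : nle a a.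
Proof. by exists (a^-1 * a); rewrite ?idempotentVs // mulgA mulsVs. Qed.

Lemma nle0x a : nle sgzero a.
Proof. by exists sgzero; rewrite ?idempotent0 ?muls0. Qed.

Lemma nle_trans b a c : nle a b -> nle b c -> nle a c.
Proof.
move=> [e he ->] [f hf ->]; exists (f * e); first exact: idempotentM.
by rewrite mulgA.
Qed.

Lemma nle_anti a b : nle a b -> nle b a -> a = b.
Proof.
move=> [e he aE] [f hf bE]; rewrite [LHS]aE [in LHS]bE -mulgA.
rewrite -(idempotentC he hf) mulgA [RHS]bE; congr (_ * _).
by rewrite aE -mulgA (eqP he).
Qed.

(** Conjugation moves the idempotent of the natural order to the other side. *)
Lemma nleP a b : nle a b <-> exists2 f, idempotent f & a = f * b.
Proof.
split=> -[e he ->].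
  by exists (b * e * b^-1); [exact: idempotent_conj | exact: idempotent_mulr].
exists (b^-1 * e * b); [exact: idempotent_conjV | exact: idempotent_mull].
Qed.

Lemma nle_mull s a b : nle a b -> nle (s * a) (s * b).
Proof. by move=> [e he ->]; exists e; rewrite ?mulgA. Qed.

Lemma nle_mulr s a b : nle a b -> nle (a * s) (b * s).
Proof. by move=> /nleP[e he ->]; apply/nleP; exists e; rewrite ?mulgA. Qed.

Lemma nle_mul a b c d : nle a b -> nle c d -> nle (a * c) (b * d).
Proof.
by move=> ab cd; apply: (nle_trans (nle_mulr c ab)); apply: nle_mull.
Qed.

Lemma nle_inv a b : nle a b -> nle a^-1 b^-1.
Proof.
move=> [e he ->]; apply/nleP; exists e => //.
by rewrite sginvM (idempotentV he).
Qed.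

Lemma nle0 a : nle a sgzero -> a = sgzero.
Proof. by move=> [e _ ->]; rewrite mul0s. Qed.

Lemma nle_idempotent e f : idempotent f -> nle e f -> f * e = e.
Proof. by move=> /eqP ff [g _ ->]; rewrite mulgA ff. Qed.

Lemma is_join_uniq (X : set S) c d : is_join X c -> is_join X d -> c = d.
Proof.
by move=> [cu cl] [du dl]; apply: nle_anti; [exact: cl | exact: dl].
Qed.

Lemma is_join_eq0 (X : set S) c :
  is_join X c -> (forall x, X x -> x = sgzero) -> c = sgzero.
Proof.
by move=> [_ cl] X0; apply: nle0; apply: cl => x /X0 ->; exact: nlexx.
Qed.

Lemma compatible_refl a : compatible a a.
Proof. by split; [exact: idempotentVs | exact: idempotentsV]. Qed.

Lemma compatible_idem e f : idempotent e -> idempotent f -> compatible e f.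
Proof.
by move=> he hf; split; rewrite !idempotentV //; exact: idempotentM.
Qed.

Lemma compatible_mull s a b : compatible a b -> compatible (s * a) (s * b).
Proof.
move=> [h1 h2]; split; rewrite sginvM.
  rewrite -mulgA (mulgA _ s) (idempotent_mull b (idempotentVs s)) mulgA.
  by apply: idempotentM => //; apply/idempotent_conjV/idempotentVs.
by rewrite -mulgA (mulgA a) mulgA; exact: idempotent_conj.
Qed.

Lemma orthogonal_compatible a b : orthogonal a b -> compatible a b.
Proof. by move=> [h1 h2]; rewrite /compatible h1 h2; split; exact: idempotent0. Qed.

End InverseSemigroupTheory.

(** * Joins of finite compatible sets *)

Section FiniteJoins.
Local Open Scope classical_set_scope.
Local Open Scope group_scope.
Local Notation "x ^-1" := (sginv x) : group_scope.

Variable S : booleanMonoidType.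
Implicit Types a b c d e f s t x y : S.

Lemma idempotentP e : idempotent e <-> nle e 1.
Proof.
by split=> [he|[f hf ->]]; [exists e; rewrite ?mul1g | rewrite mul1g].
Qed.

Lemma is_join_idempotent (X : set S) c :
  (forall x, X x -> idempotent x) -> is_join X c -> idempotent c.
Proof. by move=> XE [_ cl]; apply/idempotentP/cl => x /XE /idempotentP. Qed.

(** The distributive law is part of the induction: the join [c] of the tail is
    compatible with the head [a] because [a^-1 * c] and [c * a^-1] are joins of
    idempotents. *)
Lemma seq_join_exists (l : seq S) :
  {in l &, forall x y, compatible x y} ->
  exists c, forall s t, is_join [set s * x * t | x in [set` l]] (s * c * t).
Proof.
have [dist_ex dist] : is_distributive S by have [] := @booleansP S.
elim: l => [|a l IH] cl.
  exists sgzero => s t; rewrite muls0 mul0s.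
  by split=> [x [y]|d _]; [rewrite /= in_nil | exact: nle0x].
have [|c cP] := IH.
  by move=> x y xl yl; apply: cl; rewrite inE ?xl ?yl orbT.
have ac : compatible a c.
  split.
    have := cP a^-1 1; rewrite mulg1; apply: is_join_idempotent.
    move=> _ [x /= xl <-]; rewrite mulg1.
    by have [] := cl a x (mem_head _ _) (mem_behead (s := a :: l) xl).
  have : idempotent (c * a^-1).
    have := cP 1 a^-1; rewrite mul1g; apply: is_join_idempotent.
    move=> _ [x /= xl <-]; rewrite mul1g.
    by have [] := cl x a (mem_behead (s := a :: l) xl) (mem_head _ _).
  by move=> h; rewrite -[a * c^-1]sginvK idempotentV !sginvM !sginvK.
have [d dP] := dist_ex _ _ ac; exists d => s t.
have [sdP _] := dist _ _ _ s ac dP.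
have [_ [du dl]] := dist _ _ _ t (compatible_mull s ac) sdP.
have [cu cl'] := cP s t; split.
  move=> y [x /=]; rewrite inE => /orP[/eqP ->|xl] <-; first by apply: du; left.
  by apply: (nle_trans _ (du _ (or_intror erefl))); apply: cu; exists x.
move=> b bP; apply: dl => _ [->|->].
  by apply: bP; exists a; rewrite //= mem_head.
by apply: cl' => _ [x /= xl <-]; apply: bP; exists x; rewrite //= inE xl orbT.
Qed.

Variable X : set S.
Hypothesis finX : finite_set X.
Hypothesis cptX : forall x y, X x -> X y -> compatible x y.

Lemma is_join_exists : exists c, is_join X c.
Proof.
have /finite_seqP[l lE] := finX.
have [|c cP] := @seq_join_exists l.
  by move=> x y xl yl; apply: cptX; rewrite lE.
exists c; have := cP 1 1; rewrite mul1g mulg1 -lE.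
congr is_join; apply/seteqP; split=> [_ [x Xx <-]|x Xx]; rewrite ?mul1g ?mulg1 //.
by exists x; rewrite ?mul1g ?mulg1.
Qed.

(** Distributivity over the join of a finite set of pairwise compatible elements,
    on both sides at once. *)
Lemma is_join_mul s t c :
  is_join X c -> is_join [set s * x * t | x in X] (s * c * t).
Proof.
have /finite_seqP[l lE] := finX.
have [|d dP] := @seq_join_exists l.
  by move=> x y xl yl; apply: cptX; rewrite lE.
have dX : is_join X d.
  have := dP 1 1; rewrite mul1g mulg1 -lE.
  congr is_join; apply/seteqP; split=> [_ [x Xx <-]|x Xx]; rewrite ?mul1g ?mulg1 //.
  by exists x; rewrite ?mul1g ?mulg1.
by move=> /is_join_uniq/(_ dX) ->; rewrite lE; exact: dP.
Qed.

End FiniteJoins.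

(** * Dissections *)

Section Dissection.
Local Open Scope classical_set_scope.
Local Open Scope group_scope.
Local Notation "x ^-1" := (sginv x) : group_scope.

Variable S : booleanMonoidType.

(** An inequality in the type monoid of [S], between the formal sums
    [\sum_i s i] and [\sum_j t j]: each [s i] is cut into the domains of pieces
    [x k], which carry them onto pairwise orthogonal parts of the [t j].  Pieces
    are listed by [K], and several may share source and target, so that
    composing dissections needs no joins; a rook matrix results from joining the
    pieces that share both. *)
Definition dissects (I J : finType) (s : I -> idem S) (t : J -> idem S) :
    Prop :=
  exists (K : finType) (x : K -> S) (src : K -> I) (tgt : K -> J),
  [/\ forall i, is_join [set (x k)^-1 * x k | k in [set k | src k = i]]
                        (val (s i)),
      forall k l, k != l -> src k = src l -> x k * (x l)^-1 = sgzero,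
      forall k l, k != l -> tgt k = tgt l -> (x k)^-1 * x l = sgzero
    & forall k, val (t (tgt k)) * x k = x k].

Lemma idemVs (e : idem S) : (val e)^-1 * val e = val e.
Proof. by rewrite (idempotentV (valP e)) (eqP (valP e)). Qed.

Lemma is_join_idemVs (I : Type) (s : I -> idem S) i :
  is_join [set (val (s k))^-1 * val (s k) | k in [set k | k = i]] (val (s i)).
Proof.
split=> [_ [k /= -> <-]|d]; first by rewrite idemVs; exact: nlexx.
by apply; exists i; rewrite //= idemVs.
Qed.

(** The idempotents [s i] themselves are the pieces. *)
Lemma dissects_embed (I J : finType) (s : I -> idem S) (t : J -> idem S)
    (phi : I -> J) :
  injective phi -> (forall i, nle (val (s i)) (val (t (phi i)))) ->
  dissects s t.
Proof.
move=> phi_inj st; exists I, (fun i => val (s i)), id, phi; split.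
- exact: (is_join_idemVs s).
- by move=> k l /eqP.
- by move=> k l /eqP kl /phi_inj.
- move=> k; apply: nle_idempotent => //; exact: valP.
Qed.

Lemma dissects_refl (I : finType) (s : I -> idem S) : dissects s s.
Proof. by apply: (@dissects_embed _ _ s s id) => // i; exact: nlexx. Qed.

(** Two dissections compose by cutting every piece [x k] of the first along
    the pieces [y l] of the second that start where [x k] ends; pairs that do
    not match contribute [sgzero]. *)
Lemma dissects_trans (J I H : finType)
    (t : J -> idem S) (s : I -> idem S) (w : H -> idem S) :
  dissects s t -> dissects t w -> dissects s w.
Proof.
move=> [K [x [src [mid [xjoin xdom xran xmid]]]]].
move=> [L [y [src' [tgt [yjoin ydom yran ytgt]]]]].
pose z (kl : K * L) : S := if mid kl.1 == src' kl.2 then y kl.2 * x kl.1 else sgzero.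
exists (K * L)%type, z, (src \o fst), (tgt \o snd); split.
- move=> i; have [xu xl] := xjoin i; split=> [_ [[k l] /= ki <-]|d dP].
    apply: (@nle_trans _ ((x k)^-1 * x k)); last by apply: xu; exists k.
    rewrite /z /=; case: eqP => _; last by rewrite muls0; exact: nle0x.
    rewrite sginvM -!mulgA; apply: nle_mull; rewrite !mulgA.
    by apply/nleP; exists ((y l)^-1 * y l); rewrite ?idempotentVs.
  apply: xl => _ [k /= ki <-].
  have -> : (x k)^-1 * x k = (x k)^-1 * val (t (mid k)) * x k.
    by rewrite -mulgA xmid.
  (* [val (t (mid k))] is the join of the domains of the pieces starting at
     [mid k]; conjugating it by [x k] cuts the domain of [x k]. *)
  case: (is_join_mul _ _ (x k)^-1 (x k) (yjoin (mid k))) => [|_ _ [l _ <-] [l' _ <-]|_].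
  + exact/finite_image/finite_finset.
  + by apply: compatible_idem; exact: idempotentVs.
  apply=> _ [_ [l /= lk <-] <-].
  apply: (@nle_trans _ ((z (k, l))^-1 * z (k, l))).
    by rewrite /z /= lk eqxx sginvM !mulgA; exact: nlexx.
  by apply: dP; exists (k, l).
- move=> [k l] [k' l'] /= kl kk'; rewrite /z /=.
  case: eqP => kmid; last by rewrite mul0s.
  case: eqP => kmid'; last by rewrite sginv0 muls0.
  rewrite sginvM -mulgA (mulgA (x k)).
  have [kE|kk] := eqVneq k k'; last by rewrite xdom // mul0s muls0.
  rewrite -kE mulgA; apply: mulsV_eq0_idem; first exact: idempotentsV.
  apply: ydom; last by rewrite -kmid -kmid' kE.
  by apply: contraNneq kl => ->; rewrite kE.
- move=> [k l] [k' l'] /= kl ll'; rewrite /z /=.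
  case: eqP => kmid; last by rewrite sginv0 mul0s.
  case: eqP => kmid'; last by rewrite muls0.
  rewrite sginvM -mulgA (mulgA (y l)^-1).
  have [lE|lk] := eqVneq l l'; last by rewrite yran // mul0s muls0.
  rewrite -lE mulgA; apply: mulVs_eq0_idem; first exact: idempotentVs.
  apply: xran; last by rewrite kmid kmid' lE.
  by apply: contraNneq kl => ->; rewrite lE.
- move=> [k l]; rewrite /z /=; case: eqP => _; last by rewrite muls0.
  by rewrite mulgA ytgt.
Qed.

Definition fam_add (I J : finType) (s : I -> idem S) (t : J -> idem S)
    (i : I + J) : idem S :=
  match i with inl j => s j | inr j => t j end.

Definition fam1 (e : idem S) (i : unit) : idem S := e.

Lemma dissects_add (I I' J J' : finType) (s : I -> idem S) (s' : I' -> idem S)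
    (t : J -> idem S) (t' : J' -> idem S) :
  dissects s t -> dissects s' t' -> dissects (fam_add s s') (fam_add t t').
Proof.
move=> [K [x [src [tgt [xjoin xdom xran xtgt]]]]].
move=> [L [y [src' [tgt' [yjoin ydom yran ytgt]]]]].
pose cut (A B A' B' : Type) (f : A -> A') (g : B -> B') (u : A + B) : A' + B' :=
  match u with inl a => inl (f a) | inr b => inr (g b) end.
exists (K + L)%type, (fun u => match u with inl k => x k | inr l => y l end).
exists (cut _ _ _ _ src src'), (cut _ _ _ _ tgt tgt'); split.
- move=> [i|i].
    have [xu xl] := xjoin i; split=> [|d dP].
      by move=> _ [[k|l] //= [ki] <-]; apply: xu; exists k.
    by apply: xl => _ [k /= ki <-]; apply: dP; exists (inl k); rewrite //= ki.
  have [xu xl] := yjoin i; split=> [|d dP].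
    by move=> _ [[k|l] //= [ki] <-]; apply: xu; exists l.
  by apply: xl => _ [k /= ki <-]; apply: dP; exists (inr k); rewrite //= ki.
- by move=> [k|k] [l|l] //= kl [kl']; [exact: xdom | exact: ydom].
- by move=> [k|k] [l|l] //= kl [kl']; [exact: xran | exact: yran].
- by move=> [k|k]; [exact: xtgt | exact: ytgt].
Qed.

Lemma dissects_addC (I J : finType) (s : I -> idem S) (t : J -> idem S) :
  dissects (fam_add s t) (fam_add t s).
Proof.
pose phi (i : I + J) : J + I := match i with inl a => inr a | inr b => inl b end.
apply: (@dissects_embed _ _ _ _ phi) => [[a|a] [b|b] //= [->] //|].
by move=> [a|a]; exact: nlexx.
Qed.

(** The element [s] is the only piece. *)
Lemma dissects_ran s : dissects (fam1 (idem_dom s)) (fam1 (idem_ran s)).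
Proof.
exists unit, (fun=> s), (fun=> tt), (fun=> tt); split=> [[]|[] []|[] []|[]] //.
  by split=> [_ [_ _ <-]|d]; [exact: nlexx | apply; exists tt].
by rewrite /= mulsVs.
Qed.

Lemma dissects_dom s : dissects (fam1 (idem_ran s)) (fam1 (idem_dom s)).
Proof.
have := dissects_ran s^-1; rewrite /idem_dom /idem_ran.
by congr (dissects (fam1 _) (fam1 _)); apply: val_inj; rewrite /= sginvK.
Qed.

Lemma dissects_merge (e f g : idem S) :
  orthogonal (val e) (val f) -> is_join [set val e; val f] (val g) ->
  dissects (fam_add (fam1 e) (fam1 f)) (fam1 g).
Proof.
move=> [ef0 _] [gu _]; pose s := fam_add (fam1 e) (fam1 f).
exists _, (fun i => val (s i)), id, (fun=> tt); split.
- exact: (is_join_idemVs s).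
- by move=> k l /eqP.
- by move=> [[]|[]] [[]|[]] // _ _ //; apply: mulVs_eq0C.
- move=> k; apply: nle_idempotent; first exact: valP.
  by apply: gu; case: k => k; [left | right].
Qed.

Lemma dissects_split (e f g : idem S) :
  orthogonal (val e) (val f) -> is_join [set val e; val f] (val g) ->
  dissects (fam1 g) (fam_add (fam1 e) (fam1 f)).
Proof.
move=> [_ ef0] [gu gl]; pose s := fam_add (fam1 e) (fam1 f).
exists _, (fun i => val (s i)), (fun=> tt), id; split.
- move=> []; split=> [_ [k _ <-]|d dP].
    by rewrite idemVs; apply: gu; case: k => k; [left | right].
  apply: gl => _ [->|->]; apply: dP; [exists (inl tt)|exists (inr tt)] => //;
    exact: idemVs.
- by move=> [[]|[]] [[]|[]] // _ _ //; apply: mulsV_eq0C.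
- by move=> k l /eqP.
- by move=> k; rewrite (eqP (valP (s k))).
Qed.

End Dissection.

(** * States on preordered commutative monoids *)

Section TarskiTheorem.
Import Order.TTheory GRing.Theory Num.Theory.
Local Open Scope classical_set_scope.
Local Open Scope ring_scope.

Variables (R : realType) (T : Type) (prec : T -> T -> Prop).
Variables (add : T -> T -> T) (zero u : T).

(* Associativity, commutativity and neutrality hold up to the equivalence
   induced by [prec], which spares a quotient. *)
Hypothesis prec_refl : forall a, prec a a.
Hypothesis prec_trans : forall b a c, prec a b -> prec b c -> prec a c.
Hypothesis prec_add : forall a b c d, prec a b -> prec c d -> prec (add a c) (add b d).
Hypothesis prec_addA : forall a b c, prec (add a (add b c)) (add (add a b) c).
Hypothesis prec_addC : forall a b, prec (add a b) (add b a).
Hypothesis prec_add0 : forall a, prec (add zero a) a.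
Hypothesis prec_addr : forall a b, prec a (add a b).

Definition nmul n a := iter n (add a) zero.

Hypothesis bounded : forall a, exists n, prec a (nmul n u).
Hypothesis not_paradoxical : forall n, ~ prec (nmul n.+1 u) (nmul n u).

Definition eqv a b := prec a b /\ prec b a.

Lemma eqv_trans b a c : eqv a b -> eqv b c -> eqv a c.
Proof. by move=> [ab ba] [bc cb]; split; apply: (@prec_trans b). Qed.

Lemma eqv_sym a b : eqv a b -> eqv b a.
Proof. by move=> []. Qed.

Lemma eqv_add a b c d : eqv a b -> eqv c d -> eqv (add a c) (add b d).
Proof. by move=> [ab ba] [cd dc]; split; apply: prec_add. Qed.

Lemma eqv_refl a : eqv a a. Proof. by split. Qed.

Lemma eqv_addC a b : eqv (add a b) (add b a).
Proof. by split. Qed.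

Lemma eqv_addA a b c : eqv (add a (add b c)) (add (add a b) c).
Proof.
split=> //; apply: (prec_trans (prec_addC _ _)); apply: (prec_trans (prec_addA _ _ _)).
apply: (prec_trans (prec_addC _ _)); apply: (@prec_trans (add b (add c a))) => //.
apply: (prec_trans (prec_addA _ _ _)); exact: prec_addC.
Qed.

Lemma eqv_add0 a : eqv (add zero a) a.
Proof. by split=> //; apply: (prec_trans (prec_addr a zero)). Qed.

Lemma eqv_addAC a b c : eqv (add (add a b) c) (add (add a c) b).
Proof.
apply: (eqv_trans (eqv_sym (eqv_addA _ _ _))).
apply: eqv_trans (eqv_addA _ _ _).
exact: eqv_add (eqv_refl _) (eqv_addC _ _).
Qed.

Lemma eqv_addACA a b c d :
  eqv (add (add a b) (add c d)) (add (add a c) (add b d)).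
Proof.
apply: (eqv_trans (eqv_addA _ _ _)); apply: eqv_trans (eqv_sym (eqv_addA _ _ _)).
exact: eqv_add (eqv_addAC _ _ _) (eqv_refl _).
Qed.

Lemma prec_0 a : prec zero a.
Proof. exact: prec_trans (prec_addr zero a) (prec_add0 a). Qed.

Lemma nmulDn m n a : eqv (nmul (m + n) a) (add (nmul m a) (nmul n a)).
Proof.
elim: m => [|m IH]; first exact/eqv_sym/eqv_add0.
apply: eqv_trans (eqv_addA _ _ _).
exact: eqv_add (eqv_refl _) IH.
Qed.

Lemma nmulDr n a b : eqv (nmul n (add a b)) (add (nmul n a) (nmul n b)).
Proof.
elim: n => [|n IH]; first exact/eqv_sym/eqv_add0.
apply: eqv_trans (eqv_addACA _ _ _ _).
exact: eqv_add (eqv_refl _) IH.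
Qed.

Lemma prec_nmul n a b : prec a b -> prec (nmul n a) (nmul n b).
Proof. by move=> ab; elim: n => [|n IH] //; apply: prec_add. Qed.

(** Subadditive monotone functionals that are exact along [u].  Exactness for
    every [a], rather than the mere normalization [p u = 1], is what keeps
    [p u] from dropping when a gauge is replaced by a smaller one. *)
Definition gauge (p : T -> R) : Prop :=
  [/\ forall a b, prec a b -> p a <= p b,
      forall a b, p (add a b) <= p a + p b,
      p zero = 0
    & forall a, p (add a u) = p a + 1].

Lemma gauge_eqv p a b : gauge p -> eqv a b -> p a = p b.
Proof.
by move=> [mono _ _ _] [ab ba]; apply/eqP; rewrite eq_le !mono.
Qed.

Lemma gauge_nmul_le p n a : gauge p -> p (nmul n a) <= n%:R * p a.
Proof.
move=> [_ sub p0 _]; elim: n => [|n IH]; first by rewrite p0 mul0r.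
by apply: (le_trans (sub _ _)); rewrite -natr1 mulrDl mul1r addrC lerD.
Qed.

Lemma gauge_add_nmul_u p n a : gauge p -> p (add a (nmul n u)) = p a + n%:R.
Proof.
move=> gp; have [_ _ _ pu] := gp; elim: n => [|n IH].
  rewrite addr0; apply: gauge_eqv => //.
  exact: eqv_trans (eqv_addC _ _) (eqv_add0 _).
rewrite -natr1 addrA -IH -pu; apply: gauge_eqv => //.
apply: eqv_trans (eqv_addA _ _ _).
exact: eqv_add (eqv_refl _) (eqv_addC _ _).
Qed.

(** A downward directed family is subadditive in the limit even if none of its
    members is. *)
Lemma gauge_inf (F : set (T -> R)) :
  F !=set0 ->
  (forall f, F f ->
    [/\ forall a b, prec a b -> f a <= f b, f zero = 0
      & forall a, f (add a u) = f a + 1]) ->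
  (forall f g, F f -> F g ->
    exists2 h, F h & forall a b, h (add a b) <= f a + g b) ->
  gauge (fun a => inf [set f a | f in F]) /\
  (forall f, F f -> forall a, inf [set f a | f in F] <= f a).
Proof.
move=> [f0 Ff0] FP Fdir; set q := fun a => inf _.
have qle f : F f -> forall a, q a <= f a.
  move=> Ff a; apply: ge_inf; last by exists f.
  exists 0 => _ [g Fg <-]; have [mono g0 _] := FP _ Fg.
  by rewrite -g0 mono //; exact: prec_0.
have qge a x : (forall f, F f -> x <= f a) -> x <= q a.
  move=> xP; apply: lb_le_inf; first by exists (f0 a), f0.
  by move=> _ [g Fg <-]; exact: xP.
split=> //; split.
- move=> a b ab; apply: qge => f Ff; apply: (le_trans (qle f Ff a)).
  by have [mono _ _] := FP _ Ff; exact: mono.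
- move=> a b; rewrite -lerBlDr; apply: (qge) => f Ff.
  rewrite lerBlDr -lerBlDl; apply: qge => g Fg; rewrite lerBlDl.
  have [h Fh hP] := Fdir f g Ff Fg.
  exact: (le_trans (qle h Fh _)) (hP a b).
- apply/eqP; rewrite eq_le; apply/andP; split.
    by have [_ <- _] := FP _ Ff0; exact: qle.
  by apply: qge => f /FP[_ -> _].
- move=> a; apply/eqP; rewrite eq_le; apply/andP; split.
    rewrite -lerBlDr; apply: qge => f Ff; rewrite lerBlDr.
    by have [_ _ <-] := FP _ Ff; exact: qle.
  by apply: qge => f Ff; have [_ _ ->] := FP _ Ff; rewrite lerD2r qle.
Qed.

(** The gauge is the least [d] such that [y + k u] is below [(k + d) u] for some
    [k].  Allowing the surplus [k u] makes it exact along [u], since [prec] is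
    not cancellative; the absence of paradoxes is used to see that adding [u]
    raises it by at least one. *)
Lemma gauge_exists : exists p, gauge p.
Proof.
pose P y d := `[< exists k, prec (add y (nmul k u)) (nmul (k + d) u) >].
have Pex y : exists d, P y d.
  have [n yn] := bounded y; exists n; apply/asboolP; exists 0%N.
  exact: prec_trans (prec_addC _ _) (prec_trans (prec_add0 _) yn).
pose deg y := ex_minn (Pex y).
have degP y : exists k, prec (add y (nmul k u)) (nmul (k + deg y) u).
  by rewrite /deg; case: ex_minnP => d /asboolP.
have deg_le y k d : prec (add y (nmul k u)) (nmul (k + d) u) -> (deg y <= d)%N.
  by move=> h; rewrite /deg; case: ex_minnP => m _; apply; apply/asboolP; exists k.
exists (fun y => (deg y)%:R); split.
- move=> a b ab; rewrite ler_nat; have [k kP] := degP b.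
  by apply: (@deg_le _ k); apply: prec_trans kP; exact: prec_add.
- move=> a b; rewrite -natrD ler_nat; have [k kP] := degP a; have [l lP] := degP b.
  apply: (@deg_le _ (k + l)%N); rewrite addnACA.
  apply: (@prec_trans (add (add a (nmul k u)) (add b (nmul l u)))).
    apply: (@prec_trans (add (add a b) (add (nmul k u) (nmul l u)))).
      by apply: prec_add => //; exact: (nmulDn _ _ _).1.
    exact: (eqv_addACA _ _ _ _).1.
  apply: prec_trans (nmulDn _ _ _).2.
  exact: prec_add.
- apply/eqP; rewrite pnatr_eq0 -leqn0; apply: (@deg_le _ 0%N).
  exact: prec_add0.
- move=> a; rewrite natr1; congr (_%:R).
  have shift k : eqv (add (add a u) (nmul k u)) (add a (nmul k.+1 u)).
    exact/eqv_sym/eqv_addA.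
  apply/eqP; rewrite eqn_leq; apply/andP; split.
    have [k kP] := degP a; apply: (@deg_le _ k); rewrite addnS.
    apply: prec_trans (prec_add (prec_refl u) kP).
    apply: prec_trans (eqv_addA _ _ _).2; exact: prec_add.
  have [k kP] := degP (add a u); have {}kP := prec_trans (shift k).2 kP.
  case E : (deg (add a u)) kP => [|d] kP; last first.
    by rewrite ltnS; apply: (@deg_le _ k.+1); rewrite addSnnS.
  case: (@not_paradoxical k); rewrite addn0 in kP; apply: prec_trans kP.
  exact: prec_trans (prec_addr _ a) (prec_addC _ _).
Qed.

(** Zorn's lemma; chains are bounded by pointwise infima. *)
Lemma minimal_gauge_exists :
  exists2 p, gauge p &
    forall q, gauge q -> (forall a, q a <= p a) -> q = p.
Proof.
have [p0 gp0] := gauge_exists.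
pose G := {p : T -> R | gauge p}.
pose below (p q : G) := `[< forall a, sval q a <= sval p a >].
have [||A Atot|[p gp] pmin] := @ZL_preorder G (exist _ p0 gp0) below.
- by move=> p; apply/asboolP.
- move=> r s t /asboolP rs /asboolP st; apply/asboolP => a.
  exact: le_trans (st a) (rs a).
- have [->|/set0P[g Ag]] := eqVneq A set0; first by exists (exist _ p0 gp0).
  have [|f [r _ <-]|f1 f2 [r1 Ar1 <-] [r2 Ar2 <-]|gq qP] :=
      @gauge_inf [set sval r | r in A].
  + by exists (sval g), g.
  + by have [mono _ p00 pu] := svalP r.
  + have [/asboolP r12|/asboolP r21] := Atot _ _ Ar1 Ar2.
      exists (sval r2) => [|a b]; first by exists r2.
      have [_ sub _ _] := svalP r2.
      by apply: (le_trans (sub a b)); rewrite lerD2r.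
    exists (sval r1) => [|a b]; first by exists r1.
    have [_ sub _ _] := svalP r1.
    by apply: (le_trans (sub a b)); rewrite lerD2l.
  + exists (exist _ _ gq) => r Ar; apply/asboolP => a /=.
    by apply: qP; exists r.
exists p => // q gq qp; apply/funext => a; apply/eqP; rewrite eq_le qp /=.
have /(_ (exist _ q gq)) := pmin; rewrite /below => /(_ _)/asboolP.
by apply; apply/asboolP.
Qed.

(** The functional [a |-> p (n a) / n] is a gauge below [p]. *)
Lemma minimal_gauge_nmul p n a :
  gauge p -> (forall q, gauge q -> (forall a, q a <= p a) -> q = p) ->
  p (nmul n a) = n%:R * p a.
Proof.
move=> gp pmin; case: n => [|n]; first by have [_ _ -> _] := gp; rewrite mul0r.
have n0 : 0 < n.+1%:R :> R by rewrite ltr0n.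
pose q a := p (nmul n.+1 a) / n.+1%:R.
suff <- : q a = p a by rewrite mulrC divfK // gt_eqF.
rewrite (pmin q) //.
- have [mono sub p0 pu] := gp; split.
  + by move=> x y xy; rewrite ler_pM2r ?invr_gt0 // mono //; exact: prec_nmul.
  + move=> x y; rewrite /q -mulrDl ler_pM2r ?invr_gt0 //.
    by rewrite (gauge_eqv gp (nmulDr _ _ _)) sub.
  + rewrite /q; have -> : p (nmul n.+1 zero) = 0; last by rewrite mul0r.
    apply/eqP; rewrite eq_le -[X in _ && (X <= _)]p0 mono ?andbT; last exact: prec_0.
    by apply: (le_trans (gauge_nmul_le _ _ gp)); rewrite p0 mulr0.
  + move=> x; rewrite /q (gauge_eqv gp (nmulDr _ _ _)) gauge_add_nmul_u // mulrDl.
    by rewrite divff // gt_eqF.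
- by move=> x; rewrite ler_pdivrMr // mulrC; exact: gauge_nmul_le.
Qed.

(** The functional [y |-> inf_n (p (y + n x) - n p x)] is a gauge below [p], hence
    equals [p]; the term [n = 1] then gives the missing inequality
    [p y <= p (y + x) - p x].  Homogeneity of [p] makes each term vanish at
    [zero]. *)
Lemma minimal_gauge_add p x y :
  gauge p -> (forall q, gauge q -> (forall a, q a <= p a) -> q = p) ->
  p (add y x) = p y + p x.
Proof.
move=> gp pmin; have [mono sub p0 pu] := gp.
pose f n y := p (add y (nmul n x)) - n%:R * p x.
have [|_ [n _ <-]|_ _ [m _ <-] [n _ <-]|gq qf] := @gauge_inf (range f).
- by exists (f 0%N), 0%N.
- split=> [a b ab||a].
  + by rewrite lerD2r mono //; exact: prec_add.
  + by rewrite /f (gauge_eqv gp (eqv_add0 _)) (minimal_gauge_nmul _ _ gp pmin) subrr.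
  + by rewrite /f (gauge_eqv gp (eqv_addAC _ _ _)) pu addrAC.
- exists (f (m + n)%N) => [|a b]; first by exists (m + n)%N.
  have e : eqv (add (add a b) (nmul (m + n) x))
             (add (add a (nmul m x)) (add b (nmul n x))).
    apply: (eqv_trans (eqv_add (eqv_refl _) (nmulDn _ _ _))).
    exact: eqv_addACA.
  rewrite /f (gauge_eqv gp e) natrD mulrDl opprD addrACA lerD2r.
  exact: sub.
have qp := pmin _ gq.
apply/eqP; rewrite eq_le sub /= -lerBrDr.
rewrite -[X in X y]qp.
  apply: (le_trans (qf (f 1%N) _ y)); first by exists 1%N.
  rewrite /f mul1r lerD2r mono //; apply: prec_add => //.
  by apply: (prec_trans (prec_addC _ _)); exact: prec_add0.
move=> a; apply: (le_trans (qf (f 0%N) _ a)); first by exists 0%N.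
rewrite /f mul0r subr0 mono //; apply: (prec_trans (prec_addC _ _)).
exact: prec_add0.
Qed.

(** Tarski's theorem: a commutative monoid, preordered with every element above
    [zero], in which no [(n + 1) u] is below [n u] for the order unit [u], has an
    additive monotone functional with value 1 at [u]. *)
Theorem tarski_state :
  exists p : T -> R,
    [/\ forall a b, prec a b -> p a <= p b,
        forall a b, p (add a b) = p a + p b,
        forall a, 0 <= p a
      & p u = 1].
Proof.
have [p gp pmin] := minimal_gauge_exists; have [mono _ p0 pu] := gp.
exists p; split=> // [a b|a|].
- exact: minimal_gauge_add.
- by rewrite -p0 mono //; exact: prec_0.
- by rewrite -(gauge_eqv gp (eqv_add0 u)) pu p0 add0r.
Qed.

End TarskiTheorem.

(** * From dissections to Tarski matrices *)

Section TarskiMatrices.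
Local Open Scope classical_set_scope.
Local Open Scope group_scope.
Local Notation "x ^-1" := (sginv x) : group_scope.

Variable S : booleanMonoidType.

(** Formal sums are sequences of idempotents from here on: they form a small
    type, as Zorn's lemma over functionals on them requires, whereas the
    families indexed by all finite types do not. *)
Definition item (s : seq (idem S)) (i : 'I_(size s)) : idem S :=
  nth (idem1 S) s i.

Definition seq_dissects (s t : seq (idem S)) : Prop :=
  dissects (@item s) (@item t).

Lemma item_cat s t (i : 'I_(size (s ++ t))) :
  item i = fam_add (@item s) (@item t) (fintype.split (cast_ord (size_cat s t) i)).
Proof.
rewrite /item nth_cat; case: splitP => j /= ->; first by rewrite ltn_ord.
by rewrite ltnNge leq_addr /= addKn.
Qed.

Lemma dissects_cat s t : dissects (@item (s ++ t)) (fam_add (@item s) (@item t)).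
Proof.
apply: (@dissects_embed _ _ _ _ _ (fun i => fintype.split (cast_ord (size_cat s t) i))).
  exact: inj_comp (can_inj splitK) (@cast_ord_inj _ _ _).
by move=> i; rewrite item_cat; exact: nlexx.
Qed.

Lemma dissects_uncat s t : dissects (fam_add (@item s) (@item t)) (@item (s ++ t)).
Proof.
pose phi i := cast_ord (esym (size_cat s t)) (unsplit i).
apply: (@dissects_embed _ _ _ _ _ phi).
  exact: inj_comp (@cast_ord_inj _ _ _) (can_inj unsplitK).
by move=> i; rewrite item_cat cast_ordKV unsplitK; exact: nlexx.
Qed.

Lemma dissects_seq1 e : dissects (fam1 e) (@item [:: e]).
Proof.
by apply: (@dissects_embed _ _ _ _ _ (fun=> ord0)) => [[] []|i] //; exact: nlexx.
Qed.

Lemma dissects_unseq1 e : dissects (@item [:: e]) (fam1 e).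
Proof.
apply: (@dissects_embed _ _ _ _ _ (fun=> tt)) => [i j _|i].
  by rewrite (ord1 i) (ord1 j).
by rewrite (ord1 i); exact: nlexx.
Qed.

Lemma seq_dissects_cat s s' t t' :
  seq_dissects s s' -> seq_dissects t t' -> seq_dissects (s ++ t) (s' ++ t').
Proof.
move=> ss tt; apply: dissects_trans (dissects_uncat _ _).
by apply: (dissects_trans (dissects_cat _ _)); exact: dissects_add.
Qed.

Lemma seq_dissects_catC s t : seq_dissects (s ++ t) (t ++ s).
Proof.
apply: dissects_trans (dissects_uncat _ _).
by apply: (dissects_trans (dissects_cat _ _)); exact: dissects_addC.
Qed.

Lemma seq_dissects_prefix s t : seq_dissects s (s ++ t).
Proof.
have le : size s <= size (s ++ t) by rewrite size_cat leq_addr.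
apply: (@dissects_embed _ _ _ _ _ (widen_ord le)) => [i j [ij]|i].
  exact: ord_inj.
 by rewrite /item nth_cat /= ltn_ord; exact: nlexx.
Qed.

Lemma seq_dissects_unit s : seq_dissects s (nseq (size s) (idem1 S)).
Proof.
have e : size s = size (nseq (size s) (idem1 S)) by rewrite size_nseq.
apply: (@dissects_embed _ _ _ _ _ (cast_ord e)) => [|i]; first exact: cast_ord_inj.
by rewrite {2}/item nth_nseq if_same; apply/idempotentP/valP.
Qed.

Lemma nmul_cat1 n : nmul cat [::] n [:: idem1 S] = nseq n (idem1 S).
Proof. by elim: n => //= n ->. Qed.

(** The entry [A i j] joins the pieces that lead from the [j]-th copy of 1 to the
    [i]-th.  A piece is below its entry, so the domains of the entries in column
    [j] have join 1. *)
Lemma tarski_of_dissects m :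
  seq_dissects (nseq m.+1 (idem1 S)) (nseq m (idem1 S)) ->
  exists A : 'M[S]_(m, m.+1), is_tarski A.
Proof.
move=> [K [x [src' [tgt' [xjoin xdom xran _]]]]].
pose src k := cast_ord (size_nseq _ _) (src' k).
pose tgt k := cast_ord (size_nseq _ _) (tgt' k).
have {}xdom k l : k != l -> src k = src l -> x k * (x l)^-1 = sgzero.
  by move=> kl /cast_ord_inj; exact: xdom.
have {}xran k l : k != l -> tgt k = tgt l -> (x k)^-1 * x l = sgzero.
  by move=> kl /cast_ord_inj; exact: xran.
pose X (i : 'I_m) (j : 'I_m.+1) := [set x k | k in [set k | src k = j /\ tgt k = i]].
have Xfin i j : finite_set (X i j) by exact/finite_image/finite_finset.
have Xcpt i j a b : X i j a -> X i j b -> compatible a b.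
  move=> [k [/= kj ki] <-] [l [/= lj li] <-].
  have [->|kl] := eqVneq k l; first exact: compatible_refl.
  by apply: orthogonal_compatible; split; [apply: xran | apply: xdom];
    rewrite ?ki ?kj.
have Xex i j : exists c, is_join (X i j) c.
  exact: is_join_exists (Xfin i j) (@Xcpt i j).
pose A : 'M[S]_(m, m.+1) := (\matrix_(i, j) projT1 (cid (Xex i j)))%R.
have AP i j : is_join (X i j) (A i j) by rewrite mxE; case: cid.
have A0 i j s t : (forall a, X i j a -> s * a * t = sgzero) -> s * A i j * t = sgzero.
  move=> h; apply: is_join_eq0 (is_join_mul (Xfin i j) (@Xcpt i j) s t (AP i j)) _.
  by move=> _ [a /h ? <-].
have Arook : is_rook A.
  split=> [i j j' jj'|i i' j ii'].
    rewrite -[LHS]mulg1; apply: (A0) => _ [l [/= lj li] <-]; rewrite mulg1.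
    apply: mulVs_eq0C; rewrite -[LHS]mulg1; apply: (A0) => _ [k [/= kj ki] <-].
    rewrite mulg1; apply: xran; last by rewrite li ki.
    by apply: contraNneq jj' => lk; rewrite -kj -lj lk.
  rewrite -[A i j]mul1g; apply: (A0) => _ [k [/= kj ki] <-]; rewrite mul1g.
  apply: mulsV_eq0C; rewrite -[A i' j]mul1g; apply: (A0) => _ [l [/= lj li] <-].
  rewrite mul1g; apply: xdom; last by rewrite lj kj.
  by apply: contraNneq ii' => lk; rewrite -ki -li lk.
exists A; split=> // j j'; rewrite [rook_id _ _ _ _]mxE.
have [<-|jj'] := eqVneq j j'; last first.
  split=> [_ [i _ <-]|d _]; last exact: nle0x.
  by rewrite mxE (Arook.1 i j j' jj'); exact: nlexx.
split=> [_ [i _ <-]|d dP].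
  by rewrite mxE; apply/idempotentP; exact: idempotentVs.
have [_] := xjoin (cast_ord (esym (size_nseq _ _)) j).
rewrite /item nth_nseq if_same; apply=> _ [k /= kj <-].
have {}kj : src k = j by rewrite /src kj cast_ordKV.
apply: (@nle_trans _ ((A (tgt k) j)^-1 * A (tgt k) j)).
  have xA : nle (x k) (A (tgt k) j) by apply: (AP _ _).1; exists k.
  exact: nle_mul (nle_inv xA) xA.
by apply: dP; exists (tgt k); rewrite // mxE.
Qed.

End TarskiMatrices.

(** * Invariant means *)

Section Means.
Import Order.TTheory GRing.Theory Num.Theory.
Local Open Scope classical_set_scope.
Local Open Scope group_scope.
Local Open Scope ring_scope.

Variables (R : realType) (S : booleanMonoidType).

(** The mean of [e] is the value of Tarski's functional at the one-term sum [e];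
    invariance and additivity come from dissections in both directions. *)
Lemma mean_of_no_tarski :
  (forall m : nat, (1 <= m)%N -> ~ exists A : 'M[S]_(m, m.+1), is_tarski A) ->
  exists mu : idem S -> R, is_invariant_mean mu.
Proof.
move=> noT; pose u := [:: idem1 S].
have npos m : ~ seq_dissects (nseq m.+2 (idem1 S)) (nseq m.+1 (idem1 S)).
  by move=> h; apply: (noT m.+1) => //; exact: tarski_of_dissects.
have [|||||||||p [mono padd pge0 p1]] :=
  @tarski_state R (seq (idem S)) (@seq_dissects S) cat [::] u.
- by move=> s; exact: dissects_refl.
- by move=> t s w; exact: dissects_trans.
- by move=> *; exact: seq_dissects_cat.
- by move=> s t w; rewrite catA; exact: dissects_refl.
- exact: seq_dissects_catC.
- by move=> s; exact: dissects_refl.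
- exact: seq_dissects_prefix.
- by move=> s; exists (size s); rewrite nmul_cat1; exact: seq_dissects_unit.
- (* The degree of a Tarski matrix is positive, so a paradox with [n = 0] is
     turned into one with [n = 1] by adding a copy of 1. *)
  move=> n; rewrite !nmul_cat1; case: n => [|m]; last exact: npos.
  move=> h; apply: (npos 0%N).
  by apply: (@seq_dissects_cat _ u u _ _ _ h); exact: dissects_refl.
have mono1 e f : dissects (fam1 e) (fam1 f) -> p [:: e] <= p [:: f].
  move=> ef; apply: mono; apply: (dissects_trans (dissects_unseq1 e)).
  exact: dissects_trans ef (dissects_seq1 f).
exists (fun e => p [:: e]); split=> // [s|e f g ef gP].
  by apply/eqP; rewrite eq_le !mono1 //; [exact: dissects_dom | exact: dissects_ran].
rewrite -padd; apply/eqP; rewrite eq_le !mono //.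
  apply: dissects_trans (dissects_seq1 g).
  apply: dissects_trans (dissects_merge ef gP).
  apply: (dissects_trans (dissects_cat _ _)).
  by apply: dissects_add; exact: dissects_unseq1.
apply: (dissects_trans (dissects_unseq1 g)).
apply: (dissects_trans (dissects_split ef gP)).
apply: dissects_trans (dissects_uncat _ _).
by apply: dissects_add; exact: dissects_seq1.
Qed.

Variable mu : idem S -> R.
Hypothesis mu_mean : is_invariant_mean mu.

Lemma orthogonal_idem (e f : idem S) :
  (val e * val f)%g = sgzero -> orthogonal (val e) (val f).
Proof. by move=> ef; rewrite /orthogonal !idempotentV //; exact: valP. Qed.

(** Compare with a relative complement of [e] in 1. *)
Lemma mean_le1 e : mu e <= 1.
Proof.
have [mu_ge0 _ muD mu1] := mu_mean.
have [_ compl] := @booleansP S.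
have [g [gi eg gP]] := compl _ _ (valP e) (idempotent1 S) ((idempotentP _).1 (valP e)).
have -> : 1 = mu e + mu (exist _ g gi).
  by rewrite -mu1; apply: muD => //; exact: orthogonal_idem.
by rewrite lerDl.
Qed.

Lemma mean_sum (I : finType) (F : I -> idem S) :
  (forall i j, i != j -> (val (F i) * val (F j))%g = sgzero) ->
  exists2 g, is_join (range (fun i => val (F i))) (val g) & mu g = \sum_i mu (F i).
Proof.
move=> F0; have [_ _ muD _] := mu_mean.
suff [g gP gE] : exists2 g,
    is_join [set val (F i) | i in [set` index_enum I]] (val g)
    & mu g = \sum_(i <- index_enum I) mu (F i).
  exists g => //; congr is_join : gP; congr image.
  by apply/seteqP; split=> // i _; rewrite /= mem_index_enum.
elim: (index_enum I) (index_enum_uniq I) => [_|i l IH /= /andP[il ul]].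
  pose z : idem S := exist _ sgzero (idempotent0 S); exists z.
    by split=> [x [y]|d _]; [rewrite /= in_nil | exact: nle0x].
  apply: (@addrI _ (mu z)); rewrite big_nil addr0; apply/esym/muD.
    by apply: orthogonal_idem; rewrite mul0s.
  by split=> [x [->|->]|d]; [exact: nlexx | exact: nlexx | apply; left].
have [g gP gE] := IH ul.
have ig : (val (F i) * val g)%g = sgzero.
  rewrite -[LHS]mulg1.
  apply: is_join_eq0 (is_join_mul _ _ (val (F i)) 1%g gP) _.
  - exact/finite_image/finite_finset.
  - by move=> _ _ [j _ <-] [k _ <-]; apply: compatible_idem; exact: valP.
  move=> _ [_ [j /= jl <-] <-]; rewrite mulg1; apply: F0.
  by apply: contraNneq il => ->.
have [c cP] : exists c, is_join [set val (F i); val g] c.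
  have [[ex _] _] := @booleansP S; apply: ex.
  by apply/orthogonal_compatible/orthogonal_idem.
have hc : idempotent c.
  by apply: is_join_idempotent cP => _ [->|->]; exact: valP.
exists (exist _ c hc) => /=; last first.
  rewrite big_cons -gE; apply: muD => //; exact: orthogonal_idem.
have [[gu gl] [cu cl]] := (gP, cP); split=> [_ [j /= jl <-]|d dP].
  move: jl; rewrite inE => /orP[/eqP ->|jl]; first by apply: cu; left.
  by apply: (nle_trans (gu _ _) (cu _ _)); [exists j | right].
apply: cl => _ [->|->]; first by apply: dP; exists i; rewrite //= mem_head.
by apply: gl => _ [j /= jl <-]; apply: dP; exists j; rewrite //= inE jl orbT.
Qed.

(** Double counting: the domains of the entries sum to 1 in each of the [m.+1]
    columns, while their ranges sum to at most 1 in each of the [m] rows. *)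
Lemma no_tarski_of_mean m (A : 'M[S]_(m, m.+1)) : ~ is_tarski A.
Proof.
move=> [[Arow Acol] AA]; have [_ mu_inv _ mu1] := mu_mean.
have col j : \sum_i mu (idem_dom (A i j)) = 1.
  have [|g gP <-] := @mean_sum _ (fun i => idem_dom (A i j)).
    move=> i i' ii'; rewrite /= -mulgA (mulgA (A i j)).
    by rewrite Acol // mul0s muls0.
  rewrite -mu1; congr mu; apply: val_inj; apply: is_join_uniq gP _.
  have := AA j j; rewrite mxE eqxx; congr is_join.
  by congr image; apply/funext => i; rewrite mxE.
have row i : \sum_j mu (idem_ran (A i j)) <= 1.
  have [|g _ <-] := @mean_sum _ (fun j => idem_ran (A i j)); last exact: mean_le1.
  move=> j j' jj'; rewrite /= -mulgA (mulgA (sginv (A i j))).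
  by rewrite Arow // mul0s muls0.
have : \sum_(j < m.+1) \sum_i mu (idem_dom (A i j)) <= m%:R.
  rewrite exchange_big /= -[m in m%:R]card_ord -sum1_card natr_sum.
  apply: ler_sum => i _; apply: le_trans (row i).
  by apply: ler_sum => j _; rewrite mu_inv.
rewrite (eq_bigr (fun=> 1)) => [|j _]; last exact: col.
by rewrite big_const_ord iter_addr_0 ler_nat ltnn.
Qed.

End Means.

Theorem theorem3p13 (R : realType) (S : booleanMonoidType) :
  (exists mu : idem S -> R, is_invariant_mean mu) <->
  (forall m : nat, (1 <= m)%N -> ~ exists A : 'M[S]_(m, m.+1), is_tarski A).
Proof.
split; last exact: mean_of_no_tarski.
by move=> [mu mu_mean] m _ [A]; exact: no_tarski_of_mean mu_mean m A.
Qed.
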